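(* Let $\mathcal{T}$ be a background first-order theory, let $\varphi$ be a quantifier-free $\mathcal{T}$-formula, and let $\boldsymbol{\alpha}$ be a finite set of atoms containing all atoms occurring in $\varphi$. Let $\boldsymbol{\alpha}_{\mathcal{B}}$ and $\boldsymbol{\alpha}_{\mathcal{T}}$ be the sets of Boolean atoms and of theory atoms in $\boldsymbol{\alpha}$, respectively, so that every total truth assignment $\eta$ on $\boldsymbol{\alpha}$ is uniquely written as $\eta=\eta_{\mathcal{T}}\wedge\eta_{\mathcal{B}}$ with $\eta_{\mathcal{T}}$ a total truth assignment on $\boldsymbol{\alpha}_{\mathcal{T}}$ and $\eta_{\mathcal{B}}$ a total truth assignment on $\boldsymbol{\alpha}_{\mathcal{B}}$. Let $$BC_{\mathcal{T}}(\varphi)=\{\neg\eta_{\mathcal{T}} \;:\; \eta_{\mathcal{T}}\wedge\eta_{\mathcal{B}}\in H_{\boldsymbol{\alpha}}(\varphi)\},$$ and let $Cl$ be a set of $\mathcal{T}$-lemmas such that $BC_{\mathcal{T}}(\varphi)\cup Cl$ rules out $P_{\boldsymbol{\alpha}}(\varphi)$. Then $Cl$ rules out $P_{\boldsymbol{\alpha}}(\varphi)$.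
   Context: A $\mathcal{T}$-formula is a Boolean combination (via $\neg,\wedge,\vee,\to,\leftrightarrow$) of Boolean atoms (propositional variables) and $\mathcal{T}$-atoms (quantifier-free atomic formulas of the theory $\mathcal{T}$). A total truth assignment on a set of atoms $\boldsymbol{\alpha}$ is a conjunction containing exactly one literal (the atom or its negation) for each atom of $\boldsymbol{\alpha}$. The Boolean abstraction maps each Boolean atom to itself and each $\mathcal{T}$-atom to a fresh propositional variable (injectively), homomorphically w.r.t. Boolean connectives; a conjunction of literals $\eta$ propositionally satisfies $\varphi$, written $\eta\models_p\varphi$, if the Boolean abstraction of $\eta$ entails that of $\varphi$ in propositional logic; $\psi\equiv_{\mathcal{B}}\bot$ means the Boolean abstraction of $\psi$ is propositionally unsatisfiable. $H_{\boldsymbol{\alpha}}(\varphi)$ denotes the set of total truth assignments $\eta$ on $\boldsymbol{\alpha}$ with $\eta\models_p\varphi$ that are $\mathcal{T}$-satisfiable (consistent in $\mathcal{T}$); $P_{\boldsymbol{\alpha}}(\varphi)$ denotes the set of total truth assignments $\rho$ on $\boldsymbol{\alpha}$ with $\rho\models_p\varphi$ that are $\mathcal{T}$-unsatisfiable. A $\mathcal{T}$-lemma is a $\mathcal{T}$-valid clause. A set of clauses $\{C_1,\dots,C_K\}$ rules out a set $\{\rho_1,\dots,\rho_M\}$ of total truth assignments iff for every $\rho_j$ there is some $C_l$ with $\rho_j\models_p\neg C_l$, i.e. iff $\bigvee_j\rho_j\wedge\bigwedge_l C_l\equiv_{\mathcal{B}}\bot$. *)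

(* Defs.v *)
From Stdlib Require List.
From mathcomp Require Import all_boot.
From mathcomp Require Import boolp classical_sets functions cardinality.

Set Implicit Arguments.
Unset Strict Implicit.
Unset Printing Implicit Defensive.

Local Open Scope classical_set_scope.

Record signature := Signature {
  fsym : Type;
  farity : fsym -> nat;
  psym : Type;
  parity : psym -> nat }.

(* Arguments are stored in finite functions rather than plain functions, so
   that Leibniz equality of terms and atoms is syntactic identity. *)
Inductive term (S : signature) : Type :=
  | Var of nat
  | App (f : fsym S) of {ffun 'I_(farity f) -> term S}.

Inductive tatom (S : signature) : Type :=
  | TEq of term S & term S
  | TPred (p : psym S) of {ffun 'I_(parity p) -> term S}.

(* The remaining connectives and the existential quantifier are definable from
   these, as the semantics is classical. *)
Inductive fo_formula (S : signature) : Type :=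
  | FoAtom of tatom S
  | FoBot
  | FoImp of fo_formula S & fo_formula S
  | FoAll of nat & fo_formula S.

Arguments FoBot {S}.

Fixpoint term_fv S (t : term S) : set nat :=
  match t with
  | Var x => [set x]
  | App f args => [set x | exists i, term_fv (args i) x]
  end.

Definition tatom_fv S (a : tatom S) : set nat :=
  match a with
  | TEq t u => term_fv t `|` term_fv u
  | TPred p args => [set x | exists i, term_fv (args i) x]
  end.

Fixpoint fo_fv S (A : fo_formula S) : set nat :=
  match A with
  | FoAtom a => tatom_fv a
  | FoBot => set0
  | FoImp A1 A2 => fo_fv A1 `|` fo_fv A2
  | FoAll x A1 => fo_fv A1 `\` [set x]
  end.

Definition sentence S (A : fo_formula S) : Prop := fo_fv A = set0.

Record theory (S : signature) := Theory {
  axioms : set (fo_formula S);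
  axioms_closed : forall A, axioms A -> sentence A }.

Record structure (S : signature) := Structure {
  dom : Type;
  dom_inhabited : inhabited dom;
  fint : forall f : fsym S, ('I_(farity f) -> dom) -> dom;
  pint : forall p : psym S, ('I_(parity p) -> dom) -> Prop }.

Fixpoint term_val S (M : structure S) (e : nat -> dom M) (t : term S) : dom M :=
  match t with
  | Var x => e x
  | App f args => fint (fun i => term_val e (args i))
  end.

Definition tatom_sat S (M : structure S) (e : nat -> dom M) (a : tatom S) :
    Prop :=
  match a with
  | TEq t u => term_val e t = term_val e u
  | TPred p args => pint (fun i => term_val e (args i))
  end.

Definition update (D : Type) (e : nat -> D) (x : nat) (d : D) : nat -> D :=
  fun y => if y == x then d else e y.

Fixpoint fo_sat S (M : structure S) (e : nat -> dom M) (A : fo_formula S) :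
    Prop :=
  match A with
  | FoAtom a => tatom_sat e a
  | FoBot => False
  | FoImp A1 A2 => fo_sat e A1 -> fo_sat e A2
  | FoAll x A1 => forall d : dom M, fo_sat (update e x d) A1
  end.

Definition model S (T : theory S) (M : structure S) : Prop :=
  forall A, axioms T A -> forall e : nat -> dom M, fo_sat e A.

(* The constants serve as the empty conjunction and the empty disjunction. *)
Inductive bform (A : Type) : Type :=
  | BTrue
  | BFalse
  | BAtom of A
  | BNot of bform A
  | BAnd of bform A & bform A
  | BOr of bform A & bform A
  | BImp of bform A & bform A
  | BIff of bform A & bform A.

Arguments BTrue {A}.
Arguments BFalse {A}.

Fixpoint holds A (v : A -> Prop) (psi : bform A) : Prop :=
  match psi with
  | BTrue => True
  | BFalse => False
  | BAtom a => v a
  | BNot p => ~ holds v p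
  | BAnd p q => holds v p /\ holds v q
  | BOr p q => holds v p \/ holds v q
  | BImp p q => holds v p -> holds v q
  | BIff p q => holds v p <-> holds v q
  end.

Fixpoint bmap A B (f : A -> B) (psi : bform A) : bform B :=
  match psi with
  | BTrue => BTrue
  | BFalse => BFalse
  | BAtom a => BAtom (f a)
  | BNot p => BNot (bmap f p)
  | BAnd p q => BAnd (bmap f p) (bmap f q)
  | BOr p q => BOr (bmap f p) (bmap f q)
  | BImp p q => BImp (bmap f p) (bmap f q)
  | BIff p q => BIff (bmap f p) (bmap f q)
  end.

Fixpoint atoms A (psi : bform A) : set A :=
  match psi with
  | BTrue | BFalse => set0
  | BAtom a => [set a]
  | BNot p => atoms p
  | BAnd p q | BOr p q | BImp p q | BIff p q => atoms p `|` atoms q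
  end.

Inductive atom (S : signature) : Type :=
  | BoolAtom of nat
  | TheoryAtom of tatom S.

Arguments BoolAtom {S}.

Definition tformula (S : signature) : Type := bform (atom S).

(* The propositional variables of the abstraction: the original ones, and a
   fresh one for each theory atom. *)
Inductive pvar (S : signature) : Type :=
  | Old of nat
  | Fresh of tatom S.

Arguments Old {S}.

Definition abs_atom S (a : atom S) : pvar S :=
  match a with
  | BoolAtom p => Old p
  | TheoryAtom t => Fresh t
  end.

Definition abstraction S (psi : tformula S) : bform (pvar S) :=
  bmap (@abs_atom S) psi.

Definition pentails S (psi chi : tformula S) : Prop :=
  forall v : pvar S -> bool,
    holds (fun x => v x) (abstraction psi) ->
    holds (fun x => v x) (abstraction chi).

Definition atom_sat S (M : structure S) (e : nat -> dom M) (b : nat -> bool)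
    (a : atom S) : Prop :=
  match a with
  | BoolAtom p => b p
  | TheoryAtom t => tatom_sat e t
  end.

(* Free variables and Boolean atoms are read existentially in satisfiability
   and universally in validity. *)
Definition tsat S (T : theory S) (psi : tformula S) : Prop :=
  exists (M : structure S) (e : nat -> dom M) (b : nat -> bool),
    model T M /\ holds (atom_sat e b) psi.

Definition tvalid S (T : theory S) (psi : tformula S) : Prop :=
  forall (M : structure S) (e : nat -> dom M) (b : nat -> bool),
    model T M -> holds (atom_sat e b) psi.

(* [(a, true)] is the literal [a], [(a, false)] its negation. *)
Definition literal (S : signature) : Type := (atom S * bool)%type.

Definition lit_form S (l : literal S) : tformula S :=
  if l.2 then BAtom l.1 else BNot (BAtom l.1).

Definition neg_lit S (l : literal S) : literal S := (l.1, ~~ l.2).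

Definition cube (S : signature) : Type := seq (literal S).

Definition clause (S : signature) : Type := seq (literal S).

Definition cube_form S (eta : cube S) : tformula S :=
  foldr (fun l psi => BAnd (lit_form l) psi) BTrue eta.

Definition clause_form S (C : clause S) : tformula S :=
  foldr (fun l psi => BOr (lit_form l) psi) BFalse C.

Definition neg_cube S (eta : cube S) : clause S := map (@neg_lit S) eta.

Definition tlemma S (T : theory S) (C : clause S) : Prop :=
  tvalid T (clause_form C).

(* [List.NoDup] and [List.In] are used since atoms carry no [eqType]. *)
Definition total_assignment S (alpha : set (atom S)) (eta : cube S) : Prop :=
  List.NoDup (map fst eta) /\
  forall a : atom S, alpha a <-> List.In a (map fst eta).

Definition bool_atoms S (alpha : set (atom S)) : set (atom S) :=
  [set a | alpha a /\ exists p, a = BoolAtom p].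

Definition theory_atoms S (alpha : set (atom S)) : set (atom S) :=
  [set a | alpha a /\ exists t, a = TheoryAtom t].

Definition H_set S (T : theory S) (alpha : set (atom S)) (phi : tformula S) :
    set (cube S) :=
  [set eta | [/\ total_assignment alpha eta,
                 pentails (cube_form eta) phi &
                 tsat T (cube_form eta)]].

Definition P_set S (T : theory S) (alpha : set (atom S)) (phi : tformula S) :
    set (cube S) :=
  [set rho | [/\ total_assignment alpha rho,
                 pentails (cube_form rho) phi &
                 ~ tsat T (cube_form rho)]].

Definition BC_set S (T : theory S) (alpha : set (atom S)) (phi : tformula S) :
    set (clause S) :=
  [set C | exists etaT etaB : cube S,
     [/\ total_assignment (theory_atoms alpha) etaT,
         total_assignment (bool_atoms alpha) etaB,
         H_set T alpha phi (etaT ++ etaB) &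
         C = neg_cube etaT]].

Definition rules_out S (Cs : set (clause S)) (rhos : set (cube S)) : Prop :=
  forall rho, rhos rho ->
    exists2 C, Cs C & pentails (cube_form rho) (BNot (clause_form C)).

(* Main.v *)
(** If a T-unsatisfiable total assignment [rho] were ruled out by some
    [~ etaT] with [etaT /\ etaB] T-satisfiable, then [rho] would agree with
    [etaT] on all theory atoms. A model of [etaT], with the Boolean atoms
    reinterpreted as [rho] prescribes, would then satisfy [rho]. So only the
    clauses of [Cl] can rule out [rho]. *)
Require Import Defs.
From mathcomp Require Import all_boot.
From mathcomp Require Import boolp classical_sets functions cardinality.

Local Open Scope classical_set_scope.

Lemma holds_bmap (A B : Type) (f : A -> B) (v : B -> Prop) (psi : bform A) :
  holds v (bmap f psi) = holds (v \o f) psi.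
Proof.
by elim: psi => //= [p ->|p -> q ->|p -> q ->|p -> q ->|p -> q ->].
Qed.

Lemma holds_cube_form (S : signature) (w : atom S -> Prop) (eta : cube S) :
  holds w (cube_form eta) <->
  forall l, List.In l eta -> holds w (lit_form l).
Proof.
elim: eta => [|l eta IH] /=; first by [].
rewrite IH; split=> [[wl weta] _ [<-|/weta]//|H].
by split=> [|k keta]; apply: H; [left|right].
Qed.

Lemma holds_neg_lit (S : signature) (w : atom S -> Prop) (l : literal S) :
  ~ holds w (lit_form (neg_lit l)) <-> holds w (lit_form l).
Proof. by case: l => a [] /=; rewrite /lit_form /= ?notK. Qed.

(** De Morgan's law for literals; it turns the ruling out of [rho] by a blocking clause into the
    entailment of the blocked cube. *)
Lemma holds_neg_cube (S : signature) (w : atom S -> Prop) (eta : cube S) :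
  ~ holds w (clause_form (neg_cube eta)) <-> holds w (cube_form eta).
Proof.
elim: eta => [|l eta IH] /=; first by split=> // _ [].
by rewrite -IH -(holds_neg_lit _ _ l); split=> [/not_orP|[nl neta] []].
Qed.

(** Applied to a total assignment, this excludes an atom occurring with both signs. *)
Lemma In_fst_uniq (A B : Type) (s : seq (A * B)) (a : A) (b c : B) :
  List.NoDup (map fst s) -> List.In (a, b) s -> List.In (a, c) s -> b = c.
Proof.
elim: s => //= [[a' b'] s IH] /List.NoDup_cons_iff [nin nd].
have nins d : ~ List.In (a', d) s.
  by move=> ins; apply: nin; exact: (List.in_map fst _ _ ins).
case=> [[ea eb]|bs] [[ea' ec]|cs].
- by rewrite -eb -ec.
- by case: (nins c); rewrite ea.
- by case: (nins b); rewrite ea'.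
- exact: IH.
Qed.

(** Atoms absent from [rho] default to false, just like those occurring only negatively. *)
Definition cube_val (S : signature) (rho : cube S) (x : pvar S) : bool :=
  match x with
  | Old p => `[< List.In (BoolAtom p, true) rho >]
  | Fresh t => `[< List.In (TheoryAtom t, true) rho >]
  end.

Lemma cube_val_abs (S : signature) (rho : cube S) (a : atom S) :
  cube_val S rho (abs_atom a) = `[< List.In (a, true) rho >].
Proof. by case: a. Qed.

Lemma cube_val_lit (S : signature) (rho : cube S) (a : atom S) (s : bool) :
  List.NoDup (map fst rho) -> List.In (a, s) rho ->
  cube_val S rho (abs_atom a) = s.
Proof.
move=> nd; rewrite cube_val_abs; case: s => ars; first exact/asboolP.
by apply/asboolP => art; have := In_fst_uniq _ _ _ _ _ _ nd art ars.
Qed.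

Lemma cube_val_sat (S : signature) (rho : cube S) :
  List.NoDup (map fst rho) ->
  holds (fun x => cube_val S rho x) (abstraction (cube_form rho)).
Proof.
move=> nd; rewrite /abstraction holds_bmap; apply/holds_cube_form.
by move=> [a s] /(cube_val_lit _ _ _ _ nd); rewrite /lit_form; case: s => /= ->.
Qed.

(** The truth of theory atoms does not depend on the Boolean valuation, so that valuation can be
    replaced freely while the model and the environment are kept. *)
Lemma tsat_of_theory_part (S : signature) (T : theory S) (alpha : set (atom S))
    (rho etaT etaB : cube S) :
  total_assignment alpha rho ->
  total_assignment (theory_atoms alpha) etaT ->
  pentails (cube_form rho) (cube_form etaT) ->
  tsat T (cube_form (etaT ++ etaB)) ->
  tsat T (cube_form rho).
Proof.
move=> [nd dom_rho] [_ dom_etaT] rho_etaT [M [e [b [MT Meta]]]].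
exists M, e, (fun p => cube_val S rho (Old p)); split=> //.
apply/holds_cube_form => -[[p|t] s] lrho.
  have := cube_val_lit _ _ _ _ nd lrho.
  by rewrite /lit_form; case: s {lrho} => /= ->.
(* Both cubes are total, so [t] passes from [rho] through [alpha] to [etaT]; only its sign there
   remains to be compared. *)
have: List.In (TheoryAtom t) (map fst etaT).
  apply/dom_etaT; split; last by exists t.
  by apply/dom_rho; exact: (List.in_map fst _ _ lrho).
move=> /List.in_map_iff[[_ s'] [/= -> letaT]].
have {letaT}[letaT Mt] : s' = s /\
    holds (atom_sat e b) (lit_form (TheoryAtom t, s')).
  split; last first.
    move/holds_cube_form: Meta; apply; apply/List.in_or_app; by left.
  (* Evaluating the entailment at the valuation read off [rho] itself forces the two signs of [t] to
     agree. *)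
  have := rho_etaT _ (cube_val_sat _ _ nd).
  rewrite /abstraction holds_bmap => /holds_cube_form /(_ _ letaT).
  rewrite -(cube_val_lit _ _ _ _ nd lrho) /lit_form.
  by case: s' {letaT} => /= [->|/negP/negbTE ->].
by rewrite letaT in Mt; case: s {lrho letaT} Mt.
Qed.

Theorem theorem1 (S : signature) (T : theory S) (phi : tformula S)
    (alpha : set (atom S)) (Cl : set (clause S)) :
  finite_set alpha ->
  atoms phi `<=` alpha ->
  (forall C : clause S, Cl C -> tlemma T C) ->
  rules_out (BC_set T alpha phi `|` Cl) (P_set T alpha phi) ->
  rules_out Cl (P_set T alpha phi).
Proof.
move=> _ _ _ ruled rho Prho; have [C [BC|ClC] rhoC] := ruled rho Prho; last first.
  by exists C.
(* A blocking clause cannot rule out [rho]: it would make [rho] satisfiable in [T], against its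
   membership in [P_set]. *)
case: Prho => tot_rho _ []; move: BC => [etaT [etaB [tot_etaT _ [_ _ sat] eC]]].
apply: tsat_of_theory_part tot_rho tot_etaT _ sat => v /rhoC.
by rewrite eC /abstraction /= !holds_bmap => /holds_neg_cube.
Qed.
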